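(* Let $G$ be a finite simple graph with $n$ vertices. Then \[ \chi(\overline{G}) \ge n - \mathrm{hdim}_{\mathbb{Z}_2}(\mathcal{D}(G)) - 2, \] where $\mathbb{Z}_2=\mathbb{Z}/2\mathbb{Z}$.
   Context: $\chi$ denotes the chromatic number and $\overline{G}$ the complement graph of $G$. For $v\in V(G)$, $N_G[v]$ is the closed neighborhood ($v$ together with its neighbors). A subset $\sigma\subseteq V(G)$ is dominating if every vertex of $G$ lies in $\sigma$ or is adjacent to an element of $\sigma$. The dominance complex $\mathcal{D}(G)$ is the simplicial complex on the underlying set $V(G)$ whose simplices are the subsets of $V(G)$ whose complements are dominating in $G$. For a finite simplicial complex $X$ and a commutative ring $R$ with unit, $\mathrm{hdim}_R(X)=\sup\{ k \mid \tilde H_k(X;R)\neq 0\}\in\mathbb{Z}\cup\{-\infty\}$ (reduced homology). *)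

(* Defs.v *)
From mathcomp Require Import all_boot all_order all_algebra.
From mathcomp Require Import classical_sets constructive_ereal.

Set Implicit Arguments.
Unset Strict Implicit.
Unset Printing Implicit Defensive.

Import Order.TTheory GRing.Theory Num.Theory.
Local Open Scope ring_scope.

Record sgraph (T : finType) := SGraph {
  adj :> rel T;
  adj_sym : symmetric adj;
  adj_irr : irreflexive adj }.

Section Graphs.
Variable T : finType.
Implicit Types (G : sgraph T) (A : {set T}) (u v : T).

Definition compl_adj G : rel T := fun u v => (u != v) && ~~ G u v.

Lemma compl_adj_sym G : symmetric (compl_adj G).
Proof. by move=> u v; rewrite /compl_adj eq_sym adj_sym. Qed.

Lemma compl_adj_irr G : irreflexive (compl_adj G).
Proof. by move=> u; rewrite /compl_adj eqxx. Qed.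

Definition compl_graph G : sgraph T :=
  SGraph (@compl_adj_sym G) (@compl_adj_irr G).

Definition colorable G (k : nat) : bool :=
  [exists f : {ffun T -> 'I_k}, forall u, forall v, G u v ==> (f u != f v)].

Lemma colorable_card G : exists k, colorable G k.
Proof.
exists #|T|; apply/existsP; exists [ffun u => enum_rank u].
apply/forallP => u; apply/forallP => v; apply/implyP => Guv.
rewrite !ffunE (inj_eq enum_rank_inj).
by apply: contraTneq Guv => ->; rewrite adj_irr.
Qed.

Definition chromatic_number G : nat := ex_minn (colorable_card G).

Definition dominating G A : bool :=
  [forall v, (v \in A) || [exists u in A, G v u]].

End Graphs.

(* The empty face is allowed, and singletons need not be faces. *)
Record complex (T : finType) := Complex {
  faces :> {set {set T}};
  faces_sub : forall s t : {set T}, t \subset s -> s \in faces -> t \in faces }.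

Section DominanceComplex.
Variables (T : finType) (G : sgraph T).

Definition dominance_faces : {set {set T}} := [set s | dominating G (~: s)].

Lemma dominance_faces_sub (s t : {set T}) :
  t \subset s -> s \in dominance_faces -> t \in dominance_faces.
Proof.
rewrite !inE => ts /forallP doms; apply/forallP => v.
have sub : {subset ~: s <= ~: t} by apply/fintype.subsetP; rewrite finset.setCS.
case/orP: (doms v) => [/sub-> // | /existsP[u /andP[/sub tu Gvu]]].
by apply/orP; right; apply/existsP; exists u; rewrite tu.
Qed.

Definition dominance_complex : complex T := Complex dominance_faces_sub.

End DominanceComplex.

Section ReducedHomology.
Variables (T : finType) (R : comPzRingType) (X : complex T).

(* A k-chain is a coefficient function supported on the faces with k + 1      *)
(* vertices; for k = -1 this includes the empty face (augmented complex).     *)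
Definition chains (k : int) : set {ffun {set T} -> R} :=
  [set c : {ffun {set T} -> R} |
     forall s, c s != 0 -> s \in X /\ #|s|%:Z = k + 1]%classic.

(* Simplices are oriented by the enumeration order of T, so that              *)
(*   d [v_0, ..., v_k] = \sum_i (-1)^i [v_0, ..., v_(i-1), v_(i+1), ..., v_k] *)
(* and the value at s of the boundary of c collects the contributions of the  *)
(* sets v |: s, where the position of v is the number of u \in s before v.    *)
Definition boundary (c : {ffun {set T} -> R}) : {ffun {set T} -> R} :=
  [ffun s : {set T} => \sum_(v | v \notin s)
     (-1) ^+ #|[set u in s | (enum_rank u < enum_rank v)%N]| * c (v |: s)].

Definition cycles (k : int) : set {ffun {set T} -> R} :=
  [set c : {ffun {set T} -> R} | chains k c /\ boundary c = [ffun=> 0]]%classic.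

Definition boundaries (k : int) : set {ffun {set T} -> R} :=
  [set boundary c | c in chains (k + 1)]%classic.

(* H_k is the quotient of the k-cycles by the k-boundaries. *)
Definition homology_neq0 (k : int) : Prop :=
  ~ (cycles k `<=` boundaries k)%classic.

Definition hdim : \bar int :=
  supremum -oo%E [set k%:E%E | k in homology_neq0]%classic.

End ReducedHomology.

Arguments hdim {T} R X.

(* Main.v *)
Require Import Defs.
From mathcomp Require Import all_boot all_order all_algebra.
From mathcomp Require Import classical_sets constructive_ereal.
From mathcomp Require Import boolp zify ring.

(* Let H be the complement of G and consider the cells (A, B) with all of    *)
(* A x B edges of H, one of A, B possibly empty (the box complex of H, with  *)
(* the free involution swapping A and B). A set A has a common H-neighbour   *)
(* iff it does not dominate G; coning over such a neighbour leaves only the  *)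
(* cells (A, set0) with A dominating, i.e. with ~: A in the dominance        *)
(* complex D. So the reduced cohomology of the box complex in size           *)
(* m = |A| + |B| is the homology of D in degree n - m - 1.                   *)
(* A k-colouring of H maps the box complex equivariantly to the boundary of  *)
(* a k-dimensional cross-polytope, whose alternating cochain h satisfies     *)
(* dh = h + swap h, is 1 on the empty cell and 0 on cells of size k + 1.     *)
(* If the cohomology vanished in all sizes m <= k, then starting from the    *)
(* top one could repeatedly solve h + g + swap g = dg', down to the empty    *)
(* cell, where this reads 1 = 0. Hence H_j(D) <> 0 for some j >= n - k - 1.  *)

Set Implicit Arguments.
Unset Strict Implicit.
Unset Printing Implicit Defensive.

Import Order.TTheory GRing.Theory Num.Theory.
Local Open Scope ring_scope.

(** This is a Borsuk-Ulam obstruction read through Alexander-type duality. [cob_alt] supplies the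
    equivariant cochain of a colouring, [exact_at_colorable] makes cohomology of the box complex
    survive in some size m <= k, [cocycle_cone] and [exact_at_homology] carry it to the dominance
    complex, and [homology_neq0_hdim] bounds [hdim] from below. *)

Lemma addFF (x : 'F_2) : x + x = 0.
Proof. exact: addrr_pchar2 (pchar_Fp _) x. Qed.

Lemma addFK (x y : 'F_2) : x + (x + y) = y.
Proof. by rewrite addrA addFF add0r. Qed.

Lemma addF_eq0 (x y : 'F_2) : x + y = 0 -> x = y.
Proof. by move=> xy0; rewrite -[x]addr0 -(addFF y) addrA xy0 add0r. Qed.

Lemma signF (k : nat) : (-1) ^+ k = 1 :> 'F_2.
Proof. by rewrite oppr_pchar2 ?expr1n // pchar_Fp. Qed.

Lemma mulrbF (b : bool) (k : nat) : b%:R *+ k = (b && odd k)%:R :> 'F_2.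
Proof.
case: b; last by rewrite mul0rn.
rewrite -[k in LHS]odd_double_half mulrnDr -muln2 mulrnA.
by rewrite -[_ *+ 2]/(_ + _) addFF addr0; case: odd.
Qed.

(** The terms at (x, y) and (y, x) cancel modulo 2. *)
Lemma sum_offdiag_sym (T : finType) (A : {set T}) (phi : T -> T -> 'F_2) :
  (forall x y, phi x y = phi y x) ->
  \sum_(x in A) \sum_(y in A :\ x) phi x y = 0.
Proof.
move=> phiC.
pose L := \sum_(x in A) \sum_(y in A | (enum_rank x < enum_rank y)%N) phi x y.
have L_sym : L = \sum_(x in A) \sum_(y in A | (enum_rank y < enum_rank x)%N) phi x y.
  rewrite /L (exchange_big_dep (mem A)) /= => [|x y Ax /andP[]//].
  apply: eq_bigr => x Ax.
  by apply: eq_big => [y|y _]; [rewrite Ax | exact: phiC].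
suff -> : \sum_(x in A) \sum_(y in A :\ x) phi x y = L + L by rewrite addFF.
rewrite {2}L_sym -big_split /=.
apply: eq_bigr => x Ax.
rewrite (bigID (fun y => (enum_rank x < enum_rank y)%N)) /=; congr (_ + _).
  apply: eq_bigl => y; rewrite !inE.
  by case: eqVneq => [->|_]; rewrite ?ltnn ?andbF.
apply: eq_bigl => y.
rewrite !inE -leqNgt leq_eqVlt (inj_eq val_inj) (inj_eq enum_rank_inj).
by case: eqVneq => [->|_]; rewrite ?ltnn ?andbF.
Qed.

(** * Mod 2 cochains on pairs of sets *)

Section Cochains.
Variable T : finType.
Implicit Types (A B : {set T}) (P Q : pred T).

(* A cochain on the cells (A, B) of the box complex is a function defined on *)
(* all pairs; only its values on cells matter.                               *)
Notation cochain := ({set T} -> {set T} -> 'F_2).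
Implicit Types f g : cochain.

(** Restricting deletions to [P] lets a product be differentiated one colour class at a time;
    [predT] gives the full coboundary. *)
Definition cob P f : cochain := fun A B =>
  \sum_(a in A | P a) f (A :\ a) B + \sum_(b in B | P b) f A (B :\ b).

Definition addc f g : cochain := fun A B => f A B + g A B.
Definition swapc f : cochain := fun A B => f B A.

Lemma cobD P f g A B : cob P (addc f g) A B = cob P f A B + cob P g A B.
Proof. by rewrite /cob /addc !big_split /= addrACA. Qed.

Lemma cob_swap P f A B : cob P (swapc f) A B = cob P f B A.
Proof. by rewrite /cob addrC. Qed.

Lemma eq_cob P Q f A B : P =1 Q -> cob P f A B = cob Q f A B.
Proof.
by move=> PQ; congr (_ + _); apply: eq_bigl => x; rewrite PQ.
Qed.

Lemma cobT f A B : cob predT f A B =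
  \sum_(a in A) f (A :\ a) B + \sum_(b in B) f A (B :\ b).
Proof. by congr (_ + _); apply: eq_bigl => x; rewrite andbT. Qed.

Lemma cob_cob f A B : cob predT (cob predT f) A B = 0.
Proof.
rewrite cobT; under eq_bigr do rewrite cobT.
under [X in _ + X]eq_bigr do rewrite cobT.
rewrite !big_split /= sum_offdiag_sym; last first.
  by move=> x y; rewrite !finset.setDDl finset.setUC.
rewrite [X in _ + (_ + X)]sum_offdiag_sym; last first.
  by move=> x y; rewrite !finset.setDDl finset.setUC.
by rewrite add0r addr0 [X in _ + X]exchange_big addFF.
Qed.

Definition indep P f := forall x A B,
  P x -> f (A :\ x) B = f A B /\ f A (B :\ x) = f A B.

(** Leibniz rule: each deletion affects only one of the two factors. *)
Lemma cobM P Q f g A B :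
    (forall x, P x -> ~~ Q x) -> indep Q f -> indep P g ->
  cob (predU P Q) (fun A B => f A B * g A B) A B
    = cob P f A B * g A B + f A B * cob Q g A B.
Proof.
move=> PQ fQ gP.
have split (C : {set T}) (F : T -> 'F_2) :
    \sum_(x in C | predU P Q x) F x
      = \sum_(x in C | P x) F x + \sum_(x in C | Q x) F x.
  rewrite (bigID P) /=; congr (_ + _); apply: eq_bigl => x /=.
    by case: (P x); rewrite ?andbF ?andbT.
  by case: (boolP (P x)) => [/PQ/negPf->|_]; rewrite ?andbF ?andbT.
rewrite /cob !split mulrDl mulrDr !mulr_suml !mulr_sumr addrACA.
congr (_ + _); congr (_ + _); apply: eq_bigr => x /andP[_ Px].
- by have [-> _] := gP x A B Px.
- by have [_ ->] := gP x A B Px.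
- by have [-> _] := fQ x A B Px.
- by have [_ ->] := fQ x A B Px.
Qed.

Lemma indepM P f g : indep P f -> indep P g ->
  indep P (fun A B => f A B * g A B).
Proof.
by move=> fP gP x A B Px; have [-> ->] := fP x A B Px; have [-> ->] := gP x A B Px.
Qed.

Lemma indepD P f g : indep P f -> indep P g -> indep P (addc f g).
Proof.
move=> fP gP x A B Px; rewrite /addc.
by have [-> ->] := fP x A B Px; have [-> ->] := gP x A B Px.
Qed.

End Cochains.

Notation cochain T := ({set T} -> {set T} -> 'F_2).

(** * The alternating cochain of a colouring *)

Section Alternating.
Variables (T C : finType) (c : T -> C).
Implicit Types (A B : {set T}) (s : bool) (t : C) (l : seq C).

Definition ncol t A := #|[set x in A | c x == t]|.

Lemma ncolD1 t A x : x \in A -> ncol t (A :\ x) = (ncol t A - (c x == t))%N.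
Proof.
move=> Ax; rewrite /ncol; have -> : [set y in A :\ x | c y == t] =
    [set y in A | c y == t] :\ x by apply/setP=> y; rewrite !inE andbA.
by rewrite [in RHS](cardsD1 x) !inE Ax addKn.
Qed.

Lemma ncolD1_neq t A x : c x != t -> ncol t (A :\ x) = ncol t A.
Proof.
move=> xt; congr #|pred_of_set _|; apply/setP=> y; rewrite !inE.
by case: (eqVneq y x) => [->|]; rewrite ?(negPf xt) ?andbF.
Qed.

Definition cnt_eq t (i j : nat) : cochain T :=
  fun A B => ((ncol t A == i) && (ncol t B == j))%:R.

Lemma indep_cnt_eq (P : pred T) t i j :
  (forall x, P x -> c x != t) -> indep P (cnt_eq t i j).
Proof. by move=> Pt x A B /Pt xt; rewrite /cnt_eq !ncolD1_neq. Qed.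

(** Deleting any of the i + 1 vertices of colour t from A gives the same value, so the sum survives
    modulo 2 exactly when i is even; likewise for B and j. *)
Lemma cob_cnt_eq t i j A B : cob (fun x => c x == t) (cnt_eq t i j) A B =
  [&& ncol t A == i.+1, ncol t B == j & ~~ odd i]%:R +
  [&& ncol t A == i, ncol t B == j.+1 & ~~ odd j]%:R.
Proof.
have cardE (D : {set T}) : #|[pred x | (x \in D) && (c x == t)]| = ncol t D.
  by rewrite /ncol cardsE.
congr (_ + _).
  under eq_bigr => x /andP[Ax ct].
    rewrite /cnt_eq ncolD1 // ct; over.
  rewrite sumr_const cardE mulrbF; congr (_%:R).
  by case: (ncol t A) => [|m]; [rewrite andbF | rewrite subn1 eqSS];
    case: eqP => //= ->; rewrite ?andbF.
under eq_bigr => x /andP[Bx ct].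
  rewrite /cnt_eq ncolD1 // ct; over.
rewrite sumr_const cardE mulrbF; congr (_%:R).
case: (ncol t B) => [|m]; first by rewrite !andbF.
by rewrite subn1 eqSS; case: (_ == i) => //=; case: eqP => //= ->.
Qed.

(* Indicator of the cells whose vertices have distinct colours from [l] and, *)
(* read in the order of [l], lie alternately in A and B, starting with A iff *)
(* [s]. It represents a power of the generator w_1 on the cross-polytope.    *)
Fixpoint alt s l : cochain T :=
  if l is t :: l' then
    addc (fun A B => cnt_eq t 0 0 A B * alt s l' A B)
         (fun A B => cnt_eq t s (~~ s) A B * alt (~~ s) l' A B)
  else fun _ _ => 1.

Lemma alt_swap s l A B : alt s l B A = alt (~~ s) l A B.
Proof.
elim: l s => //= t l IH s; rewrite /addc !IH /cnt_eq negbK.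
by rewrite (andbC (ncol t B == 0)%N) (andbC (ncol t B == s)%N).
Qed.

Lemma indep_alt (P : pred T) s l : (forall x, P x -> c x \notin l) -> indep P (alt s l).
Proof.
elim: l s => [|t l IH] s Pl //=.
have Pt x : P x -> c x != t by move/Pl; rewrite inE negb_or => /andP[].
have Pl' x : P x -> c x \notin l by move/Pl; rewrite inE negb_or => /andP[].
by apply: indepD; apply: indepM; try exact: indep_cnt_eq; exact: IH.
Qed.

Lemma cob_alt s l A B : uniq l ->
    (forall t, (ncol t A == 0) || (ncol t B == 0))%N ->
  cob (fun x => c x \in l) (alt s l) A B = alt s l A B + alt (~~ s) l A B.
Proof.
move=> + AB; elim: l s => [|t l IH] s /=.
  by move=> _; rewrite addFF /cob !big_pred0 ?addr0 // => x; rewrite andbF.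
case/andP=> tl ul.
have tlP x : c x == t -> c x \notin l by move/eqP->.
have ltP x : c x \in l -> c x != t by apply: contraTneq => ->.
rewrite (eq_cob (Q := predU (fun x => c x == t) (fun x => c x \in l))) //.
rewrite cobD !cobM //; try exact: indep_alt; try exact: indep_cnt_eq.
rewrite !IH // !cob_cnt_eq /addc negbK /cnt_eq.
(* What remains depends only on the numbers of t-coloured vertices in A and B, one of which is zero;
   all counts above two behave alike. *)
move: (AB t) (alt s l A B) (alt (~~ s) l A B) => + a b.
case: s; move: (ncol t A) (ncol t B) => [|[|[|m]]] [|[|[|p]]] //= _;
  rewrite ?mul0r ?mul1r ?add0r ?addr0 ?mul0r ?mul1r ?add0r ?addr0 //.
all: by rewrite ?(addrC b a) ?addFK ?addFF.
Qed.

Lemma alt_set0 s l : alt s l finset.set0 finset.set0 = 1.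
Proof.
elim: l s => //= t l IH s; rewrite /addc !IH /cnt_eq.
have -> : ncol t finset.set0 = 0%N.
  by apply/eqP; rewrite cards_eq0; apply/eqP/setP=> x; rewrite !inE.
by case: s; rewrite /= ?mul0r ?mul1r addr0.
Qed.

Lemma sum_ncol_alt s l A B : alt s l A B != 0 ->
  (\sum_(t <- l) (ncol t A + ncol t B) <= size l)%N.
Proof.
elim: l s => [|t l IH] s /=; first by rewrite big_nil.
rewrite big_cons /addc /cnt_eq; case: andP => [[/eqP-> /eqP->]|_].
  have -> : ((0 == s) && (0 == ~~ s))%N = false by case: s.
  by rewrite mul1r mul0r addr0 => /IH/leqW.
rewrite mul0r add0r; case: andP => [[/eqP-> /eqP->]|_].
  by rewrite mul1r => /IH; case: s.
by rewrite mul0r eqxx.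
Qed.

Lemma sum_ncol A : (\sum_(t <- enum C) ncol t A)%N = #|A|.
Proof.
rewrite big_enum /= -sum1_card (partition_big c predT) //=.
apply: eq_bigr => t _; rewrite /ncol -sum1_card; apply: eq_bigl => x.
by rewrite inE.
Qed.

End Alternating.

(** * Box complex: coning and antipodal descent *)

Section BoxComplex.
Variables (T : finType) (H : sgraph T).
Implicit Types (A B : {set T}) (f g : cochain T).

Definition cell A B := [forall a in A, forall b in B, H a b].
Definition common_nbr A b := [forall a in A, H a b].

Lemma cellP A B :
  reflect (forall a b, a \in A -> b \in B -> H a b) (cell A B).
Proof.
apply: (iffP forall_inP) => [h a b /h /forall_inP ab /ab //|h a Aa].
by apply/forall_inP => b; apply: h.
Qed.

Lemma cellC A B : cell A B = cell B A.
Proof. by apply/cellP/cellP => h a b Aa Bb; rewrite adj_sym; apply: h. Qed.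

Lemma cellS A B A' B' : A' \subset A -> B' \subset B -> cell A B -> cell A' B'.
Proof.
move=> /fintype.subsetP sA /fintype.subsetP sB /cellP h.
by apply/cellP => a b /sA Aa /sB; apply: h.
Qed.

Lemma common_nbrS A A' b : A' \subset A -> common_nbr A b -> common_nbr A' b.
Proof.
move=> /fintype.subsetP sA /forall_inP h.
by apply/forall_inP => a /sA; apply: h.
Qed.

Lemma cell_common_nbr A B b : cell A B -> b \in B -> common_nbr A b.
Proof. by move=> /cellP h Bb; apply/forall_inP => a Aa; apply: h. Qed.

Lemma cellU1 A B b : cell A B -> common_nbr A b -> cell A (b |: B).
Proof.
move=> /cellP h /forall_inP hb; apply/cellP => x y Ax.
by rewrite !inE => /orP[/eqP->|]; [apply: hb | apply: h].
Qed.

(** Here m is the size at which the coboundary is evaluated, so f is constrained in size m - 1. *)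
Definition cocycle m f :=
  forall A B, cell A B -> (#|A| + #|B|)%N = m -> cob predT f A B = 0.

(* For fixed A with a common neighbour b, the cells (A, B) form a full       *)
(* simplex, and coning with apex b kills f there; proceed by increasing #|A|.*)
Lemma cocycle_cone m f : cocycle m.+1 f ->
  exists g, forall A B, cell A B -> (exists b, common_nbr A b) ->
    (#|A| + #|B|)%N = m -> f A B = cob predT g A B.
Proof.
move=> fZ.
suff low p : exists g, forall A B, cell A B -> (exists b, common_nbr A b) ->
    (#|A| + #|B|)%N = m -> (#|A| < p)%N -> f A B = cob predT g A B.
  have [g gP] := low m.+1; exists g => A B cAB nA mAB.
  by apply: gP => //; rewrite ltnS -mAB leq_addr.
elim: p => [|p [g gP]]; first by exists (fun _ _ => 0).
pose f' := addc f (cob predT g).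
have f'0 A B : cell A B -> (exists b, common_nbr A b) -> (#|A| + #|B|)%N = m ->
    (#|A| < p)%N -> f' A B = 0.
  by move=> cAB nA mAB ltp; rewrite /f' /addc (gP A B) ?addFF.
(* The cone contraction of the error [f'], confined to #|A| = p so that smaller A are
   undisturbed. *)
pose k : cochain T := fun A B =>
  if (#|A| == p) then
    if [pick b | common_nbr A b] is Some b then
      if b \in B then 0 else f' A (b |: B)
    else 0
  else 0.
have k0 A B : #|A| != p -> k A B = 0 by rewrite /k => /negPf->.
have card1 A a : a \in A -> #|A| = #|A :\ a|.+1.
  by move=> Aa; rewrite (cardsD1 a) Aa.
exists (addc g k) => A B cAB nA mAB; rewrite cobD ltnS leq_eqVlt => /orP[/eqP Ap|ltp]; last first.
  rewrite (gP A B) // [X in _ + X]cobT !big1 ?addr0 // => [x xB|x xA].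
    by rewrite k0 // neq_ltn ltp.
  by rewrite k0 // neq_ltn (leq_ltn_trans _ ltp) // subset_leq_card ?finset.subD1set.
suff <- : f' A B = cob predT k A B by rewrite /f' /addc addrC -addrA addFF addr0.
rewrite cobT big1 ?add0r; last first.
  by move=> x xA; rewrite k0 // -Ap (card1 _ _ xA) neq_ltn ltnSn.
rewrite /k Ap eqxx; case: pickP => [b nb|]; last by case: nA => b + /(_ b) => ->.
have [bB|bB] := boolP (b \in B).
  rewrite (bigD1 b) //= !inE eqxx /= finset.setD1K // big1 ?addr0 // => x /andP[_ xb].
  by rewrite !inE eq_sym xb bB.
(* In this cocycle identity, deletions from A vanish by [f'0], deleting b gives f' A B, and the
   other deletions give the coboundary of [k]. *)
have f'Z : cob predT f' A (b |: B) = 0.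
  rewrite cobD cob_cob addr0 fZ ?cellU1 //.
  by rewrite cardsU1 bB addnS mAB.
move: f'Z; rewrite cobT big1 ?add0r => [|x xA]; last first.
  apply: f'0.
  - by apply: cellS (cellU1 cAB nb); rewrite ?finset.subD1set ?fintype.subxx.
  - by exists b; apply: common_nbrS nb; rewrite finset.subD1set.
  - by rewrite cardsU1 bB; move: mAB; rewrite (card1 _ _ xA) addnS.
  - by rewrite -Ap [ltnRHS](card1 _ _ xA).
rewrite big_setU1 //= finset.setU1K // => /addF_eq0 ->; apply: eq_bigr => x xB.
have xb : b != x by apply: contraNneq bB => ->.
rewrite !inE (negPf bB) andbF; congr (f' A _).
by apply/setP => y; rewrite !inE; case: (eqVneq y b) => // ->; rewrite xb.
Qed.

Definition exact_at m := forall f, cocycle m.+1 f ->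
  exists g, forall A B, cell A B -> (#|A| + #|B|)%N = m -> f A B = cob predT g A B.

(* The antipodal descent: alternately dividing h + g + swap g by the         *)
(* coboundary ends at the empty cell, which the swap fixes, with 1 = 0.      *)
Lemma exact_at_colorable k : colorable H k ->
  ~ (forall m, (m <= k)%N -> exact_at m).
Proof.
case/existsP => c /forallP col ex.
have colP a b : H a b -> c a != c b.
  by move: (col a) => /forallP/(_ b)/implyP.
pose h := alt c true (enum 'I_k).
have hZ A B : cell A B -> cob predT h A B = h A B + h B A.
  move=> cAB; rewrite (eq_cob (Q := fun x => c x \in enum 'I_k)); last first.
    by move=> x; rewrite mem_enum.
  rewrite cob_alt ?enum_uniq // => [|t]; first by rewrite /h (alt_swap _ _ _ A B).
  rewrite /ncol !cards_eq0; apply/negPn; rewrite negb_or.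
  apply/negP => /andP[/set0Pn[a] + /set0Pn[b]]; rewrite !inE.
  move=> /andP[Aa /eqP at_] /andP[Bb /eqP bt].
  by have := colP _ _ (cellP _ _ cAB a b Aa Bb); rewrite at_ bt eqxx.
have h0 A B : (#|A| + #|B|)%N = k.+1 -> h A B = 0.
  move=> kAB; apply/eqP; apply: contraTT isT => /sum_ncol_alt.
  by rewrite big_split /= !sum_ncol kAB size_enum_ord ltnn.
suff desc j : (j <= k)%N ->
    exists g, cocycle (k - j).+1 (addc h (addc g (swapc g))).
  have [g] := desc k (leqnn k); rewrite subnn => gZ.
  have [g' g'P] := ex 0%N isT _ gZ.
  have c00 : cell finset.set0 finset.set0 by apply/cellP => a b; rewrite inE.
  have := g'P _ _ c00; rewrite cobT !big_set0 cards0 addr0 => /(_ erefl)/eqP.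
  by rewrite /addc /swapc /h alt_set0 addFF addr0 oner_eq0.
elim: j => [_|j IH ltjk].
  exists (fun _ _ => 0) => A B cAB; rewrite subn0 => kAB.
  rewrite !cobD cob_swap addFF addr0 hZ // !h0 ?addr0 //.
  by rewrite addnC.
have [g gZ] := IH (ltnW ltjk).
have [g' g'P] := ex _ (leq_subr j k) _ gZ.
exists g' => A B cAB; rewrite subnSK // => mAB.
have [cBA mBA] : cell B A /\ (#|B| + #|A|)%N = (k - j)%N by rewrite cellC addnC.
rewrite !cobD cob_swap hZ // -!g'P // /addc /swapc.
set x := h A B; set y := h B A; set u := g A B; set v := g B A.
have -> : x + y + (x + (u + v) + (y + (v + u)))
    = (x + y + (u + v)) + (x + y + (u + v)) by ring.
exact: addFF.
Qed.

End BoxComplex.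

(** * Duality with the dominance complex *)

Section Duality.
Variables (T : finType) (G : sgraph T).
Let X := dominance_complex G.
Let H := compl_graph G.

(** A common neighbour of A in the complement graph is exactly a vertex that A fails to dominate in
    G. *)
Lemma setC_dominance (A : {set T}) :
  reflect (exists b, common_nbr H A b) (~: A \notin X).
Proof.
rewrite inE finset.setCK /dominating negb_forall.
apply: (iffP existsP) => -[b].
  rewrite negb_or => /andP[bA /existsPn nb]; exists b; apply/forall_inP => a Aa.
  rewrite /= /compl_adj; have := nb a; rewrite Aa /= adj_sym => ->.
  by rewrite andbT; apply: contraNneq bA => <-.
move=> /forall_inP nb; exists b; rewrite negb_or; apply/andP; split.
  by apply/negP => /nb; rewrite /= /compl_adj eqxx.
apply/existsPn => a; apply/negP => /andP[/nb]; rewrite /= /compl_adj adj_sym.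
by move=> /andP[_ /negPf->].
Qed.

(* Sending a cell (A, set0) to the complement of A identifies what the cone  *)
(* construction leaves of the cochains with the chains of X.                 *)
Lemma exact_at_homology m :
  ~ homology_neq0 'F_2 X (#|T|%:Z - m%:Z - 1) -> exact_at H m.
Proof.
move=> /contrapT noH f fZ; have [g gP] := cocycle_cone fZ.
pose f' := addc f (cob predT g).
have f'Z A B : cell H A B -> (#|A| + #|B|)%N = m.+1 -> cob predT f' A B = 0.
  by move=> cAB mAB; rewrite cobD cob_cob addr0 fZ.
have f'0 A B : cell H A B -> ~: A \notin X -> (#|A| + #|B|)%N = m ->
    f' A B = 0.
  by move=> cAB /setC_dominance nA mAB; rewrite /f' /addc (gP A B) ?addFF.
have cA0 (A : {set T}) : cell H A finset.set0.
  by apply/cellP => a b _; rewrite inE.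
have cardC (S : {set T}) : (#|S| + #|~: S|)%N = #|T| by rewrite cardsC.
pose c := [ffun S => if (S \in X) && (#|~: S| == m) then f' (~: S) finset.set0
                     else 0].
(* Deleting a from A adds it to the complement, so boundary becomes coboundary; signs are trivial in
   ['F_2]. *)
have boundaryE (e : {ffun {set T} -> 'F_2}) (A : {set T}) :
    boundary e (~: A) = \sum_(a in A) e (~: (A :\ a)).
  rewrite ffunE; apply: eq_big => [a|a _]; first by rewrite inE negbK.
  by rewrite signF mul1r finset.setCD finset.setUC.
have cZ : cycles X (#|T|%:Z - m%:Z - 1) c.
  split=> [S|].
    rewrite /c ffunE; case: andP => [[SX /eqP Sm] _|_]; last by rewrite eqxx.
    by split=> //; have := cardC S; lia.
  apply/ffunP => S; rewrite -(finset.setCK S) boundaryE ffunE.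
  set A := ~: S; have [Am|Am] := eqVneq #|A| m.+1; last first.
    apply: big1 => a Aa; rewrite /c ffunE finset.setCK.
    have := cardsD1 a A; rewrite Aa => Aa1.
    case: eqP => [Em|]; last by rewrite andbF.
    by rewrite Aa1 Em eqxx in Am.
  transitivity (cob predT f' A finset.set0); last first.
    by apply: f'Z; rewrite ?cards0 ?addn0.
  rewrite cobT big_set0 addr0.
  apply: eq_bigr => a Aa; rewrite /c ffunE finset.setCK.
  have Aam : #|A :\ a| = m by have := cardsD1 a A; rewrite Aa Am => -[].
  rewrite Aam eqxx andbT; case: ifPn => // aX.
  by rewrite f'0 ?cards0 ?addn0.
have [e eX ec] := noH c cZ.
have e0 A : ~: A \notin X -> e (~: A) = 0.
  by move=> AX; apply: contraNeq AX => /eX[].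
pose g2 : cochain T := fun A B => if B == finset.set0 then e (~: A) else 0.
exists (addc g g2) => A B cAB mAB; rewrite cobD.
suff <- : f' A B = cob predT g2 A B by rewrite /f' /addc addrC -addrA addFF addr0.
have [B0|/set0Pn[b bB]] := eqVneq B finset.set0.
  rewrite B0 in cAB mAB *; rewrite cards0 addn0 in mAB.
  rewrite cobT big_set0 addr0 /g2 eqxx -boundaryE ec /c ffunE finset.setCK mAB.
  by rewrite eqxx andbT; case: ifPn => // AX; rewrite f'0 ?cards0 ?addn0.
(* For nonempty B, both [f'] and the coboundary of [g2] vanish, since [e] is supported on faces. *)
have AX : ~: A \notin X by apply/setC_dominance; exists b; apply: cell_common_nbr bB.
rewrite f'0 // cobT !big1 ?addr0 // => x _; rewrite /g2.
  by case: eqP => // _; apply: e0.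
by case: eqP => // B0; rewrite B0 inE in bB.
Qed.

End Duality.

(** * Homological dimension as an attained maximum *)

Lemma int_max_ex (P : int -> Prop) (k u : int) :
  P k -> (forall j, P j -> j <= u) ->
  exists k0, [/\ P k0, k <= k0 & forall j, P j -> j <= k0].
Proof.
move=> + uP; have [d] : exists d : nat, u - k <= d%:Z.
  by exists `|u - k|%N; lia.
elim: d k => [|d IH] k kd Pk.
  by exists k; split=> // j /uP; lia.
have [kmax|/existsNP[j /not_implyP[Pj /negP]]] := pselect (forall j, P j -> j <= k).
  by exists k.
rewrite -ltNge => jk.
have [|k0 [Pk0 jk0 k0max]] := IH j _ Pj; first by lia.
by exists k0; split=> //; lia.
Qed.

Section HomologicalDimension.
Variables (T : finType) (R : comPzRingType) (X : complex T).

Lemma homology_neq0_le (k : int) : homology_neq0 R X k -> k <= #|T|%:Z.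
Proof.
rewrite leNgt => Hk; apply/negP => ltk; apply: Hk => c [cX _].
have c0 : c = [ffun=> 0].
  apply/ffunP => s; rewrite ffunE; apply/eqP/negPn/negP => /cX[_].
  by have := cardsC s; lia.
exists [ffun=> 0]; first by move=> s; rewrite ffunE eqxx.
by rewrite c0; apply/ffunP => s; rewrite !ffunE big1 // => v _; rewrite ffunE mulr0.
Qed.

(** [supremum] chooses some least upper bound; uniqueness identifies it with the maximal degree. *)
Lemma homology_neq0_hdim (k : int) : homology_neq0 R X k ->
  exists2 k0, hdim R X = k0%:E%E & k <= k0.
Proof.
move=> Hk; have [k0 [Hk0 kk0 k0max]] := int_max_ex Hk homology_neq0_le.
exists k0 => //; rewrite /hdim /supremum; set S := (X in X == _).
have Sk0 : S k0%:E%E by exists k0.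
have supk0 : supremums S k0%:E%E.
  split=> [_ [j Hj <-]|y]; first by rewrite lee_fin; apply: k0max.
  by apply.
case: eqP => [S0|_]; first by rewrite S0 in Sk0.
by apply: (is_subset1_supremums _ supk0); apply: xgetI supk0.
Qed.

End HomologicalDimension.

Theorem theorem1p2 (T : finType) (G : sgraph T) (n : nat) (hn : #|T| = n) :
  (n%:Z%:E - hdim 'F_2 (dominance_complex G) - 2%:Z%:E
     <= (chromatic_number (compl_graph G))%:Z%:E)%E.
Proof.
rewrite /chromatic_number; case: ex_minnP => k colk _.
(* The degree is n - m - 1 for some m <= k, which leaves a slack of one in the stated bound. *)
suff [j Hj lej] : exists2 j, homology_neq0 'F_2 (dominance_complex G) j
    & n%:Z - k%:Z - 1 <= j.
  by have [j0 -> lej0] := homology_neq0_hdim Hj; rewrite -!EFinB lee_fin; lia.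
apply: contrapT => noH; apply: (exact_at_colorable colk) => m lemk.
apply: exact_at_homology => Hm; apply: noH; exists (#|T|%:Z - m%:Z - 1) => //.
by rewrite hn; lia.
Qed.
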